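(* Let $X$ be a real Banach space and let $x_0\in S_X$ be a $\Delta$-point. Then for every slice $S(x_0^*,\alpha)$ of $B_X$ (with $x_0^*\in S_{X^*}$, $\alpha>0$) such that $x_0\in S(x_0^*,\alpha)$, there exist sequences $(x_i)_{i\in\mathbb{N}}$ in $S(x_0^*,\alpha)$ and $(x_i^* )_{i\in\mathbb{N}}$ in $S_{X^*}$ such that $x_i^*\in S(x_0,1/i)$ for all $i\in\mathbb{N}$, and $$\|x_i-x_j\|\ge 2-\alpha\quad\text{and}\quad \|x_i^*-x_j^*\|\ge 2-\alpha$$ for all $i,j\in\mathbb{N}\cup\{0\}$ with $i\neq j$ (where the terms with index $0$ are the given $x_0$ and $x_0^*$).
   Context: All Banach spaces are real; $B_X$, $S_X$, $X^*$ denote the closed unit ball, unit sphere and dual of $X$; $\mathbb{N}=\{1,2,\dots\}$. For $x^*\in S_{X^*}$ and $\alpha>0$, the slice of $B_X$ is $S(x^*,\alpha)=\{y\in B_X: x^*(y)>1-\alpha\}$. For $x\in S_X$ and $\alpha>0$, $S(x,\alpha)=\{y^*\in B_{X^*}: y^*(x)>1-\alpha\}$ (a $w^*$-slice of $B_{X^*}$). A point $x\in S_X$ is a $\Delta$-point if $x\in\overline{\mathrm{conv}}\,\Delta_\varepsilon(x)$ for every $\varepsilon>0$, where $\Delta_\varepsilon(x)=\{y\in B_X:\|x-y\|\ge 2-\varepsilon\}$; equivalently, for every slice $S$ of $B_X$ with $x\in S$ and every $\varepsilon>0$ there is $y\in S$ with $\|x-y\|\ge 2-\varepsilon$. *)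

(* Defs.v *)
From HB Require Import structures.
From mathcomp Require Import all_boot all_order all_algebra.
From mathcomp Require Import all_classical all_reals.
From mathcomp Require Import topology normedtype convex.

Set Implicit Arguments.
Unset Strict Implicit.
Unset Printing Implicit Defensive.

Import Order.TTheory GRing.Theory Num.Theory.
Import numFieldNormedType.Exports.

Local Open Scope classical_set_scope.
Local Open Scope ring_scope.

Definition unit_ball (R : realType) (X : normedModType R) : set X :=
  [set x | `|x| <= 1].
Arguments unit_ball {R} X _.

Definition unit_sphere (R : realType) (X : normedModType R) : set X :=
  [set x | `|x| = 1].
Arguments unit_sphere {R} X _.

(* Functionals are plain functions, so that [f - g] is the pointwise
   difference; membership in [dual X] carries linearity and continuity. *)
Definition dual (R : realType) (X : normedModType R) : set (X -> R^o) :=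
  [set f | linear f /\ continuous f].
Arguments dual {R} X _.

(* Meaningful for [f] in [dual X] only: on an unbounded set [sup] is [0]. *)
Definition dual_norm (R : realType) (X : normedModType R) (f : X -> R^o) : R :=
  sup [set `|f x| | x in unit_ball X].

Definition dual_ball (R : realType) (X : normedModType R) : set (X -> R^o) :=
  [set f | dual X f /\ dual_norm f <= 1].
Arguments dual_ball {R} X _.

Definition dual_sphere (R : realType) (X : normedModType R) : set (X -> R^o) :=
  [set f | dual X f /\ dual_norm f = 1].
Arguments dual_sphere {R} X _.

Definition slice (R : realType) (X : normedModType R) (f : X -> R^o)
    (alpha : R) : set X :=
  [set y | unit_ball X y /\ f y > 1 - alpha].

Definition weak_star_slice (R : realType) (X : normedModType R) (x : X)
    (alpha : R) : set (X -> R^o) :=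
  [set f | dual_ball X f /\ f x > 1 - alpha].

Definition convex_hull (R : realType) (X : normedModType R) (A : set X) :
    set X :=
  smallest (@convex_set R X) A.

Definition Delta_set (R : realType) (X : normedModType R) (eps : R)
    (x : X) : set X :=
  [set y | unit_ball X y /\ `|x - y| >= 2 - eps].

Definition Delta_point (R : realType) (X : normedModType R) (x : X) : Prop :=
  unit_sphere X x /\
  forall eps : R, 0 < eps -> closure (convex_hull (Delta_set eps x)) x.

(* Main.v *)
Require Import Defs.
From HB Require Import structures.
From mathcomp Require Import all_boot all_order all_algebra.
From mathcomp Require Import all_classical all_reals.
From mathcomp Require Import topology normedtype convex.
From mathcomp Require Import interval_inference zify ring lra.

Set Implicit Arguments.
Unset Strict Implicit.
Unset Printing Implicit Defensive.

Import Order.TTheory GRing.Theory Num.Theory.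
Import numFieldNormedType.Exports.

Local Open Scope classical_set_scope.
Local Open Scope ring_scope.

(** Build [x_n] and [f_n] inductively.  If [F] is a continuous functional, a
    Delta-point [x0] cannot be separated from the far points, so some [y] in
    the ball with [|x0 - y| >= 2 - eps] satisfies [F y > F x0 - eta].  Apply
    this to [F = f0 + 4 (f_1 + ... + f_n)]: since each [f_i x0] is almost
    maximal, the point [y = x_{n+1}] is in the slice of [f0] and every
    [f_i y], [i <= n], is larger than [1 - alpha].  A norming functional
    [f_{n+1}] of [x0 - y] is almost [1] at [x0] and almost [-1] at [y], so
    evaluating [f_i - f_{n+1}] at [x_{n+1}] separates the functionals, and
    evaluating [f_i] at [x_{n+1} - x_i] separates the points.
    Norming functionals come from Hahn-Banach, obtained here from the fact
    that a minimal sublinear functional is linear. *)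

(** * Sublinear functionals and the Hahn-Banach theorem *)

Section Sublinear.
Variables (R : realType) (V : lmodType R).
Implicit Types (p q : V -> R) (a x y : V) (t : R).

(** Homogeneity is stated as an inequality, which is easy to check for infima; scaling back by
    [t^-1] turns it into the equality [sublinearZ]. *)
Definition sublinear q : Prop :=
  (forall x y, q (x + y) <= q x + q y) /\
  (forall t x, 0 <= t -> q (t *: x) <= t * q x).

Lemma sublinear0 q : sublinear q -> q 0 = 0.
Proof.
move=> [qD qZ]; apply/eqP; rewrite eq_le.
have := qZ 0 0 (lexx _); rewrite scale0r mul0r => -> /=.
by have := qD 0 0; rewrite addr0; lra.
Qed.

Lemma sublinearZ q t x : sublinear q -> 0 <= t -> q (t *: x) = t * q x.
Proof.
move=> sq; rewrite le_eqVlt => /predU1P[<-|t0].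
  by rewrite scale0r mul0r sublinear0.
apply/eqP; rewrite eq_le (sq.2 _ _ (ltW t0))/= -ler_pdivlMl//.
have := sq.2 t^-1 (t *: x); rewrite scalerK ?gt_eqF//; apply.
by rewrite invr_ge0 ltW.
Qed.

Lemma sublinear_geN q x : sublinear q -> - q (- x) <= q x.
Proof.
move=> sq; have := sq.1 x (- x); rewrite subrr sublinear0//; lra.
Qed.

(* The largest sublinear functional below [q] whose value at [- a] is at most
   [- q a]. *)
Definition shear q a x : R :=
  inf [set q (x + t *: a) - t * q a | t in [set t | 0 <= t]].

Section Shear.
Variables (q : V -> R) (a : V).
Hypothesis sq : sublinear q.

Lemma shear_le t x : 0 <= t -> shear q a x <= q (x + t *: a) - t * q a.
Proof.
move=> t0; apply: ge_inf; last by exists t.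
(* The infimum is genuine only if the set is bounded below; subadditivity on
   [s *: a = (x + s *: a) - x] provides this bound. *)
exists (- q (- x)) => _ [s s0 <-].
have := sq.1 (x + s *: a) (- x).
by rewrite addrAC subrr add0r sublinearZ//; lra.
Qed.

Lemma le_shear x r :
  (forall t, 0 <= t -> r <= q (x + t *: a) - t * q a) -> r <= shear q a x.
Proof.
move=> h; apply: lb_le_inf; first by exists (q (x + 0 *: a) - 0 * q a), 0 => /=.
by move=> _ [t t0 <-]; exact: h.
Qed.

Lemma shear_le_id x : shear q a x <= q x.
Proof.
by have := shear_le x (lexx 0); rewrite scale0r addr0 mul0r subr0.
Qed.

Lemma shearN : shear q a (- a) <= - q a.
Proof.
by have := shear_le (- a) ler01; rewrite scale1r addNr sublinear0// mul1r sub0r.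
Qed.

Lemma sublinear_shear : sublinear (shear q a).
Proof.
split=> [x y|t x].
  rewrite -lerBlDr; apply: le_shear => s s0.
  rewrite lerBlDr -lerBlDl; apply: le_shear => t t0.
  have := shear_le (x + y) (addr_ge0 s0 t0).
  have := sq.1 (x + s *: a) (y + t *: a).
  by rewrite addrACA -scalerDl mulrDl; lra.
rewrite le_eqVlt => /predU1P[<-|t0].
  by rewrite scale0r mul0r (le_trans (shear_le_id _))// sublinear0.
rewrite -ler_pdivrMl//; apply: le_shear => s s0.
rewrite ler_pdivrMl//; have := shear_le (t *: x) (mulr_ge0 (ltW t0) s0).
by rewrite -scalerA -scalerDr (sublinearZ _ sq (ltW t0)) mulrBr mulrA.
Qed.

End Shear.

(* Minimality forces [shear q a = q] for every [a], i.e. [q] is odd. *)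
Lemma minimal_sublinear_linear q : sublinear q ->
  (forall q', sublinear q' -> (forall x, q' x <= q x) -> q' = q) ->
  linear (q : V -> R^o).
Proof.
move=> sq qmin.
have qN x : q (- x) = - q x.
  apply/eqP; rewrite eq_le lerNl sublinear_geN// andbT.
  rewrite -{1}(qmin _ (sublinear_shear x sq) (shear_le_id x sq)).
  exact: shearN.
have qD x y : q (x + y) = q x + q y.
  apply/eqP; rewrite eq_le sq.1/=.
  by have := sq.1 (- x) (- y); rewrite -opprD !qN; lra.
have qZ t x : q (t *: x) = t * q x.
  have [t0|/ltW t0] := lerP 0 t; first exact: sublinearZ.
  by rewrite -[t]opprK scaleNr qN (sublinearZ _ sq) ?oppr_ge0 ?mulNr.
by move=> t x y; rewrite qD qZ.
Qed.

(** Zorn's lemma for the reversed pointwise order: a nonempty chain is bounded by its pointwise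
    infimum, which is finite since every sublinear functional below [p] is at least [- p (- x)] at
    [x]. *)
Lemma exists_minimal_sublinear p : sublinear p ->
  exists q, [/\ sublinear q, forall x, q x <= p x &
    forall q', sublinear q' -> (forall x, q' x <= q x) -> q' = q].
Proof.
move=> sp.
pose T := {q : V -> R | sublinear q /\ forall x, q x <= p x}.
pose ge (s t : T) := `[< forall x, sval t x <= sval s x >].
have [||||[q [sq qp]] qmin] := @Zorn T ge.
- by move=> t; apply/asboolP.
- move=> r s t /asboolP rs /asboolP st; apply/asboolP => x.
  exact: le_trans (st x) (rs x).
- move=> [s ps] [t pt] /asboolP/= st /asboolP/= ts; apply: eq_exist.
  apply/funext => x.
  by apply/eqP; rewrite eq_le st ts.
- move=> A Atot; have [->|/set0P[g0 Ag0]] := eqVneq A set0.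
    by exists (exist _ p (conj sp (fun x => lexx (p x)))).
  pose m x := inf [set sval g x | g in A].
  have mle g x : A g -> m x <= sval g x.
    move=> Ag; apply: ge_inf; last by exists g.
    exists (- p (- x)) => _ [[h [sh hp]] _ <-] /=.
    by rewrite (le_trans _ (sublinear_geN x sh))// lerN2.
  have lem x r : (forall g, A g -> r <= sval g x) -> r <= m x.
    move=> h; apply: lb_le_inf; first by exists (sval g0 x), g0.
    by move=> _ [g Ag <-]; exact: h.
  have sm : sublinear m.
    split=> [x y|t x].
      rewrite -lerBlDr; apply: (lem) => g Ag.
      rewrite lerBlDr -lerBlDl; apply: (lem) => h Ah.
      rewrite lerBlDl; have [/asboolP gh|/asboolP hg] := Atot _ _ Ag Ah.
        rewrite (le_trans (mle _ _ Ah))// (le_trans ((svalP h).1.1 _ _))//.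
        by rewrite lerD2r.
      rewrite (le_trans (mle _ _ Ag))// (le_trans ((svalP g).1.1 _ _))//.
      by rewrite lerD2l.
    rewrite le_eqVlt => /predU1P[<-|t0].
      rewrite scale0r mul0r (le_trans (mle _ _ Ag0))// sublinear0//.
      exact: (svalP g0).1.
    rewrite -ler_pdivrMl//; apply: (lem) => g Ag; rewrite ler_pdivrMl//.
    by rewrite (le_trans (mle _ _ Ag))// ((svalP g).1.2 _ _ (ltW t0)).
  have mp x : m x <= p x by rewrite (le_trans (mle _ x Ag0))// (svalP g0).2.
  by exists (exist _ m (conj sm mp)) => g Ag; apply/asboolP => x; exact: mle.
exists q; split=> // r sr rq.
have rp x : r x <= p x := le_trans (rq x) (qp x).
by have /(congr1 sval) := qmin (exist _ r (conj sr rp)) (asboolT rq).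
Qed.

(** A minimal [q] below the shear of [p] along [a] satisfies [q (- a) <= - p a], hence
    [p a <= - q (- a) <= q a]. *)
Lemma hahn_banach_sublinear p a : sublinear p ->
  exists q, [/\ linear (q : V -> R^o), forall x, q x <= p x & q a = p a].
Proof.
move=> sp; have [q [sq qle qmin]] :=
    exists_minimal_sublinear (sublinear_shear a sp).
have qp x : q x <= p x := le_trans (qle x) (shear_le_id a sp x).
exists q; split => //; first exact: minimal_sublinear_linear.
apply/eqP; rewrite eq_le qp/=.
have := sublinear_geN a sq; have := qle (- a); have := shearN a sp.
lra.
Qed.

End Sublinear.

(** * Dual functionals and Delta-points *)

Section Dual.
Variables (R : realType) (X : normedModType R).
Implicit Types (f g : X -> R^o) (x y z : X).

Lemma linear_pack f : linear f -> exists g : {linear X -> R^o}, f = g.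
Proof.
move=> lf; pose l := GRing.isLinear.Build R X R^o *:%R f lf.
by exists (HB.pack_for {linear X -> R^o} f l).
Qed.

Lemma dualZD f g (c : R) : dual X f -> dual X g ->
  dual X (fun x => f x + c * g x).
Proof.
move=> [/linear_pack[f' ->] cf] [/linear_pack[g' ->] cg]; split.
  by move=> t x y; rewrite !linearP /= /GRing.scale /=; ring.
by move=> x; apply: cvgD; [exact: cf|apply: cvgMr; exact: cg].
Qed.

(** Continuity makes [f] bounded on the ball, so the [sup] in [dual_norm] is a true supremum. *)
Lemma le_dual_norm f x : dual X f -> `|x| <= 1 -> `|f x| <= dual_norm f.
Proof.
move=> [/linear_pack[g ->] cg] x1; apply: ub_le_sup; last by exists x.
have /linear_bounded_continuous/linear_boundedP/pinfty_ex_gt0[M M0 gM] := cg.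
exists M => _ [y y1 <-]; rewrite (le_trans (gM y))//.
by rewrite ler_piMr// ltW.
Qed.

Lemma dual_sphere_norm_le f x : dual_sphere X f -> `|f x| <= `|x|.
Proof.
move=> [df f1]; have [->|x0] := eqVneq x 0.
  by have [/linear_pack[g ->] _] := df; rewrite linear0 !normr0.
have := @le_dual_norm f (`|x|^-1 *: x) df.
rewrite f1; have [/linear_pack[g ->] _] := df.
rewrite linearZ normrZ normrM !normfV !normr_id mulVf ?normr_eq0// lexx.
by move=> /(_ isT); rewrite ler_pdivrMl ?normr_gt0// mulr1.
Qed.

Lemma dual_normB f g : dual_norm (f - g) = dual_norm (g - f).
Proof.
by congr sup; apply: eq_imagel => x _; rewrite !fctE distrC.
Qed.

Lemma exists_norming_functional x : x != 0 ->
  exists2 f, dual_sphere X f & f x = `|x|.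
Proof.
move=> x0; have [|q [/linear_pack[g qE] qle qx]] :=
    @hahn_banach_sublinear R X (fun y => `|y|) x.
  by split=> [y z|t y t0]; rewrite ?ler_normD// normrZ ger0_norm.
have gle y : `|g y| <= `|y|.
  by rewrite ler_norml lerNl -linearN -qE -{1}(normrN y) !qle.
have cg : continuous g.
  apply: bounded_linear_continuous; apply/linear_boundedP.
  exists 1; split=> [|r r1 y]; first exact: real1.
  by rewrite (le_trans (gle y))// ler_peMl// ltW.
have dg : dual X g by split=> // ? ? ?; exact: linearP.
exists g; last by rewrite -qE.
split=> //; apply/eqP; rewrite eq_le; apply/andP; split.
  apply: ge_sup; first by exists `|g 0|, 0 => //; rewrite /unit_ball/= normr0.
  by move=> _ [y y1 <-]; exact: le_trans (gle y) y1.
have := @le_dual_norm g (`|x|^-1 *: x) dg.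
rewrite normrZ normfV normr_id mulVf ?normr_eq0// lexx => /(_ isT).
apply: le_trans; rewrite linearZ/= -qE qx /GRing.scale/= mulVf ?normr_eq0//.
by rewrite normr1.
Qed.

(** Otherwise the half-space where [f] is at most [f x - eta] is a convex set containing all far
    points, hence their convex hull, while the complementary open half-space is a neighbourhood of
    [x]. *)
Lemma Delta_point_dual x f (eps eta : R) :
  Delta_point x -> dual X f -> 0 < eps -> 0 < eta ->
  exists y, [/\ `|y| <= 1, 2 - eps <= `|x - y| & f x - eta < f y].
Proof.
move=> [x1 Dx] [/linear_pack[g ->] cg] eps0 eta0.
have [|y [Hy gy]] := Dx _ eps0 [set z | g x - eta < g z].
  by apply: cvgr_gt; [exact: cg|rewrite gtrBl].
apply: contrapT => nex; move: gy => /=; apply/negP; rewrite -leNgt.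
apply: (Hy [set z | g z <= g x - eta]); split.
  move=> u v l; rewrite !inE => gu gv.
  change (g (l%:num *: (u : X) + (1 - l%:num) *: (v : X)) <= g x - eta).
  have gZ t z : g (t *: z) = t * g z by rewrite linearZ.
  rewrite linearD !gZ; move: gu gv; rewrite /mkset => gu gv.
  have l0 : 0 <= l%:num by [].
  have l1 : l%:num <= 1 by [].
  nra.
move=> z [z1 xz] /=; rewrite leNgt; apply/negP => gz.
by apply: nex; exists z.
Qed.

(** A functional [g] norming [x - y] has [g x - g y >= 2 - eps] with both values in [[-1, 1]], so
    each is within [eps] of its extreme. The bound [eps < 1] ensures [x != y]. *)
Lemma Delta_point_step x f (eps eta : R) :
  Delta_point x -> dual X f -> 0 < eps -> eps < 1 -> 0 < eta ->
  exists yg : X * (X -> R^o),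
    [/\ `|yg.1| <= 1, 2 - eps <= `|x - yg.1|, f x - eta < f yg.1,
        dual_sphere X yg.2 & 1 - eps <= yg.2 x /\ yg.2 yg.1 <= - 1 + eps].
Proof.
move=> Dx df eps0 eps1 eta0.
have [y [y1 xy fy]] := Delta_point_dual Dx df eps0 eta0.
have [|g sg gxy] := @exists_norming_functional (x - y).
  by rewrite -normr_gt0; lra.
exists (y, g); split => //=.
have := le_trans (dual_sphere_norm_le y sg) y1.
rewrite ler_norml => /andP[gy _].
have gx : g x <= 1.
  have [<- _] := Dx; exact: le_trans (ler_norm _) (dual_sphere_norm_le x sg).
have gB : g (x - y) = g x - g y.
  by have [/linear_pack[h ->] _] := sg.1; exact: linearB.
by rewrite gB in gxy; split; lra.
Qed.

End Dual.

(** * The inductive construction of both sequences *)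

Lemma sum_half_pow (R : realFieldType) n :
  \sum_(i < n) (2^-1 : R) ^+ i.+1 <= 1.
Proof.
have -> : \sum_(i < n) (2^-1 : R) ^+ i.+1 = 1 - 2^-1 ^+ n.
  elim: n => [|n IH]; first by rewrite big_ord0 expr0 subrr.
  by rewrite big_ord_recr/= IH exprS; lra.
by rewrite gerBl exprn_ge0// invr_ge0.
Qed.

Theorem proposition2p1 (R : realType) (X : completeNormedModType R) (x0 : X)
    (hx0 : Delta_point x0) (f0 : X -> R^o) (alpha : R)
    (hf0 : dual_sphere X f0) (halpha : 0 < alpha)
    (hslice : slice f0 alpha x0) :
  exists (x : nat -> X) (f : nat -> X -> R^o),
    [/\ x 0%N = x0,
        f 0%N = f0,
        forall i : nat, (1 <= i)%N ->
          [/\ slice f0 alpha (x i),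
              dual_sphere X (f i)
            & weak_star_slice x0 i%:R^-1 (f i)]
      & forall i j : nat, i <> j ->
          `|x i - x j| >= 2 - alpha /\ dual_norm (f i - f j) >= 2 - alpha].
Proof.
have [x0B f0x0] := hslice.
have le1 (h : X -> R^o) z : dual_sphere X h -> `|z| <= 1 -> h z <= 1.
  move=> sh z1; apply: le_trans z1.
  exact: le_trans (ler_norm _) (dual_sphere_norm_le z sh).
(* [d] measures how deep [x0] lies inside the slice; the errors [e k] below
   sum to at most [d]. *)
have [d [d0 d1 dg]] : exists d : R, [/\ 0 < d, d < 1 &
    16 * d <= f0 x0 - (1 - alpha)].
  have m0 : 0 < Num.min 1 (f0 x0 - (1 - alpha)).
    by rewrite lt_min ltr01 subr_gt0.
  exists (Num.min 1 (f0 x0 - (1 - alpha)) / 16).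
  have [le_1 le_2] : Num.min 1 (f0 x0 - (1 - alpha)) <= 1 /\
      Num.min 1 (f0 x0 - (1 - alpha)) <= f0 x0 - (1 - alpha).
    by rewrite !ge_min !lexx orbT.
  by split; lra.
have f0x0_le1 := le1 _ _ hf0 x0B.
pose e (k : nat) : R := d * 2^-1 ^+ k.+1.
have e_gt0 k : 0 < e k by rewrite mulr_gt0// exprn_gt0 ?invr_gt0.
have e_le k : e k <= d / 2.
  rewrite ler_pM2l// exprS ler_piMr ?invr_ge0// exprn_ile1 ?invr_ge0//.
  by rewrite invf_le1 ?ler1n.
pose good k (F : X -> R^o) (yg : X * (X -> R^o)) :=
  [/\ `|yg.1| <= 1, 2 - e k <= `|x0 - yg.1|, F x0 - 4 * d < F yg.1,
      dual_sphere X yg.2 & 1 - e k <= yg.2 x0 /\ yg.2 yg.1 <= - 1 + e k].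
(* Choice needs a witness for every function, so [(x0, f0)] serves as a dummy value outside the
   dual. *)
have /choice[st stP] (kF : nat * (X -> R^o)) :
    exists yg, dual X kF.2 -> good kF.1 kF.2 yg.
  case: kF => k F; have [dF|ndF] := pselect (dual X F); last by exists (x0, f0).
  have [||yg ?] := @Delta_point_step _ _ x0 F (e k) (4 * d) hx0 dF (e_gt0 k).
  - by have := e_le k; lra.
  - lra.
  - by exists yg.
(* The weighted sum is the only state the recursion must carry: the new point and functional are
   read off from [st (k, G k)]. *)
pose G := fix G k : X -> R^o :=
  if k is k'.+1 then fun z => G k' z + 4 * (st (k', G k')).2 z else f0.
pose y k := (st (k, G k)).1.
pose g k := (st (k, G k)).2.
have dG k : dual X (G k).
  elim: k => [|k IH]; first by case: hf0.
  by apply: dualZD => //; have [_ _ _ []] := stP (k, G k) IH.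
have GE k z : G k z = f0 z + 4 * \sum_(i < k) g i z.
  elim: k => [|k IH]; first by rewrite big_ord0 mulr0 addr0.
  by rewrite /= IH big_ord_recr/= mulrDr addrA.
have y1 k : `|y k| <= 1 by have [] := stP (k, G k) (dG k).
have x0y k : 2 - e k <= `|x0 - y k| by have [] := stP (k, G k) (dG k).
have Gy k : G k x0 - 4 * d < G k (y k) by have [] := stP (k, G k) (dG k).
have sg k : dual_sphere X (g k) by have [] := stP (k, G k) (dG k).
have gx0 k : 1 - e k <= g k x0 by have [_ _ _ _ []] := stP (k, G k) (dG k).
have gy k : g k (y k) <= - 1 + e k by have [_ _ _ _ []] := stP (k, G k) (dG k).
have sum_e k : \sum_(i < k) e i <= d.
  by rewrite -mulr_sumr ler_piMr ?(ltW d0)// sum_half_pow.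
(* No [g i] can gain more than [e i] over its value at [x0], which is already at least [1 - e i]. *)
have gD k i : g i (y k) - g i x0 <= e i.
  by have := le1 _ _ (sg i) (y1 k); have := gx0 i; lra.
have GD k : f0 x0 - 4 * d <
    f0 (y k) + 4 * \sum_(i < k) (g i (y k) - g i x0).
  by have := Gy k; rewrite !GE sumrB; lra.
(* The loss [8 * d] is the tolerance [4 * d] plus a total gain of at most [4 * d] from the weighted
   [g i]. *)
have f0y k : f0 x0 - 8 * d < f0 (y k).
  have := GD k; have := sum_e k.
  have : \sum_(i < k) (g i (y k) - g i x0) <= \sum_(i < k) e i.
    by apply: ler_sum => i _.
  lra.
(* All summands other than the [j]-th exceed their value at [x0] by at most
   [e i], so the [j]-th cannot fall much below its value at [x0]. *)
have gjy k j : (j < k)%N -> 1 - alpha + 2 * d <= g j (y k).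
  move=> jk; have := GD k; rewrite (bigD1 (Ordinal jk))//= => GDj.
  have := sum_e k; rewrite (bigD1 (Ordinal jk))//=.
  have : \sum_(i < k | i != Ordinal jk) (g i (y k) - g i x0) <=
      \sum_(i < k | i != Ordinal jk) e i by apply: ler_sum => i _.
  have := gx0 j; have := e_le j; have := e_gt0 j; have := le1 _ _ hf0 (y1 k).
  lra.
(* Indices shift by one, so [i <= k] below says that [i] precedes the index [k.+1] of [y k] and
   [g k]. *)
pose x n := if n is k.+1 then y k else x0.
pose f n := if n is k.+1 then g k else f0.
have sf n : dual_sphere X (f n) by case: n.
(* The surplus [2 * d] later absorbs the errors in [gy], each at most [d / 2]. *)
have fy k i : (i <= k)%N -> 1 - alpha + 2 * d <= f i (y k).
  by case: i => [_|j] /=; [have := f0y k; lra|exact: gjy].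
have sep k i : (i <= k)%N ->
    2 - alpha <= `|x i - y k| /\ 2 - alpha <= dual_norm (f i - g k).
  move=> ik; split.
    case: i ik => [_|j jk] /=; first by have := x0y k; have := e_le k; lra.
    have := dual_sphere_norm_le (y k - y j) (sg j).
    have -> : g j (y k - y j) = g j (y k) - g j (y j).
      by have [[/linear_pack[h ->] _] _] := sg j; exact: linearB.
    rewrite (distrC (y j)); have := ler_norm (g j (y k) - g j (y j)).
    by have := gjy _ _ jk; have := gy j; have := e_le j; lra.
  have dfg : dual X (f i - g k).
    have -> : f i - g k = (fun z => f i z + -1 * g k z).
      by apply/funext => z; rewrite mulN1r.
    exact: dualZD (sf i).1 (sg k).1.
  have := le_dual_norm dfg (y1 k).
  have := ler_norm ((f i - g k) (y k)); rewrite !fctE.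
  by have := fy _ _ ik; have := gy k; have := e_le k; lra.
exists x, f; split=> // [[//|k] _|i j].
  split=> //; first by split; [exact: y1|have := f0y k; rewrite /=; lra].
  have [dgk gk1] := sg k; split; first by split=> //; rewrite gk1.
  (* Since [d < 1], the error [e k] is below [2^-1 ^+ k.+1], which is at most the inverse of
     [k.+1]. *)
  apply: lt_le_trans (gx0 k); rewrite ltrD2l ltrN2.
  apply: (@lt_le_trans _ _ (2^-1 ^+ k.+1)).
    by rewrite gtr_pMl// exprn_gt0 ?invr_gt0.
  rewrite exprVn lef_pV2 ?posrE ?exprn_gt0 ?ltr0n// -natrX ler_nat.
  exact: ltnW (ltn_expl _ _).
wlog : i j / (i < j)%N => [sym /eqP|].
  rewrite neq_ltn => /orP[ij|ji]; first by apply: sym => //; lia.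
  by rewrite distrC dual_normB; apply: sym => //; lia.
by case: j => // k ik _; exact: sep.
Qed.
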